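(* For every $\varepsilon>0$ there exists $C=C(\varepsilon)>0$ such that the following holds for every sufficiently large $n$. Let $G=(V_1,V_2)$ be a balanced bipartite graph with $|V_1|=|V_2|=n$. If $\delta(G)\ge(\tfrac12+\varepsilon)n$, then there is a $(C/n)$-vertex-spread distribution on embeddings of perfect matchings in $G$.
   Context: An embedding $\varphi:G'\hookrightarrow H$ of a (hyper)graph $G'$ into a (hyper)graph $H$ is an injection $V(G')\to V(H)$ mapping edges of $G'$ to edges of $H$. ''Embeddings of perfect matchings in $G$'' means embeddings $\varphi:M\hookrightarrow G$ where $M$ is the graph consisting of $n$ vertex-disjoint edges (on $2n$ vertices). For $q\in[0,1]$, a probability distribution $\mu$ on all embeddings $\varphi:M\hookrightarrow G$ is $q$-vertex-spread if for every two sequences of distinct vertices $x_1,\dots,x_r\in V(M)$ and distinct vertices $y_1,\dots,y_r\in V(G)$, $\mu(\{\varphi:\varphi(x_i)=y_i\text{ for all }i\in[r]\})\le q^r$. *)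

(* Defs.v *)
From mathcomp Require Import all_boot all_order all_algebra.
From mathcomp Require Import reals.

Set Implicit Arguments.
Unset Strict Implicit.
Unset Printing Implicit Defensive.

Import Order.TTheory GRing.Theory Num.Theory.
Local Open Scope ring_scope.

Record sgraph := SGraph {
  vertex :> finType;
  adj : rel vertex;
  adj_sym : symmetric adj;
  adj_irrefl : irreflexive adj }.

Definition degree (G : sgraph) (v : G) : nat := #|[set w | adj v w]|.

(* Every degree is less than #|G|, so the initial value of the minimum is
   irrelevant as soon as G has a vertex. *)
Definition min_degree (G : sgraph) : nat :=
  (\big[minn/#|G|]_(v : G) degree v)%N.

Definition bipartition (G : sgraph) (V1 V2 : {set G}) : Prop :=
  [/\ V1 :|: V2 = [set: G],
      [disjoint V1 & V2] &
      forall u v : G, adj u v ->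
        (u \in V1) && (v \in V2) || (u \in V2) && (v \in V1)].

(* The vertices (i, false) and (i, true) are the ends of the i-th edge. *)
Definition matching_adj (n : nat) : rel ('I_n * bool) :=
  fun u v => (u.1 == v.1) && (u.2 != v.2).

Lemma matching_adj_sym n : symmetric (@matching_adj n).
Proof. by move=> u v; rewrite /matching_adj eq_sym [u.2 == _]eq_sym. Qed.

Lemma matching_adj_irrefl n : irreflexive (@matching_adj n).
Proof. by move=> u; rewrite /matching_adj !eqxx. Qed.

Definition matching_graph (n : nat) : sgraph :=
  SGraph (@matching_adj_sym n) (@matching_adj_irrefl n).

Definition is_embedding (F G : sgraph) (phi : {ffun F -> G}) : bool :=
  injectiveb phi && [forall u, forall v, adj u v ==> adj (phi u) (phi v)].

Definition embedding (F G : sgraph) : finType :=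
  {phi : {ffun F -> G} | is_embedding phi}.

Definition is_distribution (R : realType) (T : finType) (mu : T -> R) : Prop :=
  (forall t, 0 <= mu t) /\ \sum_(t : T) mu t = 1.

Definition prob (R : realType) (T : finType) (mu : T -> R) (A : {set T}) : R :=
  \sum_(t in A) mu t.

Definition vertex_spread (R : realType) (F G : sgraph) (q : R)
    (mu : embedding F G -> R) : Prop :=
  0 <= q <= 1 /\
  forall (r : nat) (x : 'I_r -> F) (y : 'I_r -> G),
    injective x -> injective y ->
    prob mu [set phi : embedding F G | [forall i, val phi (x i) == y i]]
      <= q ^+ r.

(* Main.v *)
Require Import Defs.
From mathcomp Require Import all_boot all_order all_algebra.
From mathcomp Require Import reals.
From mathcomp Require Import all_fingroup.
From mathcomp Require Import zify ring lra.

(** A perfect matching of G is a permutation [s] with [E i (s i)] for all [i],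
    where [E] is the bipartite adjacency relation; the measure is uniform on
    perfect matchings together with a labelling of their edges. It suffices to
    show that at most a [(C/n)^r] fraction of the matchings agree with a given
    matching [s0] on a given set of [r] indices.

    Relabelling by [s0] makes [E] reflexive and turns those matchings into the
    valid permutations fixing [r] points. Let [N S] be the number of valid
    permutations moving only points of [S]. Rerouting three edges shows
    [N S >= c |S| N (S \ u)] as soon as every vertex is joined to more than a
    [1/2 + eps] fraction of [S], on both sides. Removing [r <= eps n / 2] points
    one by one preserves the degree condition, which settles small [r].

    For large [r] one uses [N (~: A) <= (n - r)!] and [N setT >= c^n n!]. The
    latter follows from the same inequality along a chain of sets from [setT] to
    [set0] whose members of size at least a constant all satisfy the degree
    condition. A uniformly random chain works with positive probability, by a
    factorial moment bound; the method of conditional expectations finds one. *)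

Set Implicit Arguments.
Unset Strict Implicit.
Unset Printing Implicit Defensive.

Import Order.TTheory GRing.Theory Num.Theory.
Local Open Scope nat_scope.

(** * Switchings *)

(** For reflexive [E] the condition at the fixed points outside [S] is automatic, so these are the
    perfect matchings of the bipartite graph induced by [S] on both sides. *)
Definition valid_perms (T : finType) (E : rel T) (S : {set T}) :
    {set {perm T}} :=
  [set s : {perm T} | perm_on S s & [forall i, E i (s i)]].

Definition outdeg (T : finType) (E : rel T) (S : {set T}) (i : T) : nat :=
  #|[set j in S | E i j]|.

Definition indeg (T : finType) (E : rel T) (S : {set T}) (j : T) : nat :=
  #|[set i in S | E i j]|.

Definition min_semidegree (T : finType) (E : rel T) (S : {set T}) (D : nat) :=
  forall i, i \in S -> (D <= outdeg E S i) && (D <= indeg E S i).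

Definition cycle3 (T : finType) (a b c : T) : {perm T} :=
  (tperm a b * tperm a c)%g.

Lemma cycle3E (T : finType) (a b c x : T) : a != b -> a != c -> b != c ->
  cycle3 a b c x =
    if x == a then b else if x == b then c else if x == c then a else x.
Proof.
move=> ab ac bc; rewrite /cycle3 permM.
case: (eqVneq x a) => [->|xa].
  by rewrite tpermL tpermD // eq_sym.
case: (eqVneq x b) => [->|xb]; first by rewrite tpermR tpermL.
rewrite (tpermD (x := a) (y := b)) 1?eq_sym //.
case: (eqVneq x c) => [->|xc]; first by rewrite tpermR.
by rewrite tpermD 1?eq_sym.
Qed.

Lemma card_preim_perm_on (T : finType) (S : {set T}) (P : pred T)
    (s : {perm T}) :
  perm_on S s -> #|[set j in S | P (s j)]| = #|[set j in S | P j]|.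
Proof.
move=> sS; rewrite -(card_imset _ (@perm_inj _ s)); apply: eq_card => y.
apply/imsetP/idP => [[x /[!inE] /andP[xS Px] ->]|].
  by rewrite perm_closed // xS.
rewrite inE => /andP[yS Py]; exists (s^-1%g y); last by rewrite permKV.
by rewrite inE permKV Py andbT -(perm_closed _ sS) permKV.
Qed.

Lemma cardI_ge (T : finType) (A B S : {set T}) :
  A \subset S -> B \subset S -> #|A| + #|B| - #|S| <= #|A :&: B|.
Proof.
move=> AS BS; rewrite leq_subLR cardsI.
have : #|A :|: B| <= #|S| by rewrite subset_leq_card // subUset AS BS.
have := cardsU A B; have : #|A :&: B| <= #|A| by rewrite subset_leq_card ?subsetIl.
rewrite cardsI; lia.
Qed.

Lemma perm_on_sub (T : finType) (A B : {set T}) (s : {perm T}) :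
  A \subset B -> perm_on A s -> perm_on B s.
Proof. by move=> AB /subset_trans; apply. Qed.

(* Replace the edges at u, a, b of s by (u, s a), (a, s b), (b, u), where u is a
   fixed point of s. The new permutation and a determine b, as the preimage of
   u, and hence s; so at most #|S| triples yield the same new permutation. *)
Lemma switching (T : finType) (E : rel T) (S : {set T}) (u : T) (D : nat) :
  u \in S -> min_semidegree E S D ->
  #|valid_perms E (S :\ u)| * (D.-1 * (2 * D - #|S| - 2))
    <= #|valid_perms E S| * #|S|.
Proof.
move=> uS degS.
pose ok (s : {perm T}) (p : T * T) :=
  [&& (p.1 \in S) && (p.2 \in S), [&& u != p.1, u != p.2 & p.1 != p.2] &
      [&& E u (s p.1), E p.1 (s p.2) & E p.2 u]].
pose P := [set x : {perm T} * (T * T) |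
            (x.1 \in valid_perms E (S :\ u)) && ok x.1 x.2].
apply: (@leq_trans #|P|); last first.
  rewrite -cardsX.
  pose h (x : {perm T} * (T * T)) := ((cycle3 u x.2.1 x.2.2 * x.1)%g, x.2.1).
  have sfix s : perm_on (S :\ u) s -> s u = u.
    by move=> sS; rewrite (out_perm sS) // !inE eqxx.
  have h_inj : {in P &, injective h}.
    move=> [s [a b]] [s' [a' b']] /[!inE] /=.
    rewrite /ok /= => /andP[/andP[sS _] /and3P[_ /and3P[ua ub ab] _]].
    move=> /andP[/andP[s'S _] /and3P[_ /and3P[_ ub' ab'] _]] [eqs eqa].
    move: eqs ab'; rewrite -{}eqa => eqs ab'.
    have cb : (cycle3 u a b * s)%g b = u.
      by rewrite permM cycle3E // eqxx ![b == _]eq_sym (negPf ub) (negPf ab) sfix.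
    have cb' : (cycle3 u a b' * s')%g b' = u.
      by rewrite permM cycle3E // eqxx ![b' == _]eq_sym (negPf ub') (negPf ab') sfix.
    have eqb : b = b' by apply: (@perm_inj _ (cycle3 u a b * s)%g); rewrite cb eqs cb'.
    by move: eqs; rewrite eqb => /mulgI ->.
  rewrite -(card_in_imset h_inj) subset_leq_card //.
  apply/subsetP => _ /imsetP[[s [a b]] /[!inE] /= + ->].
  rewrite /ok /= => /andP[/andP[sS /forallP Es]].
  move=> /and3P[/andP[aS bS] /and3P[ua ub ab] /and3P[Ea Eab Eb]]; rewrite aS andbT; apply/andP; split.
    apply/subsetP => x; rewrite inE permM; apply: contraR => xS.
    rewrite cycle3E //.
    have /negPf-> : x != u by apply: contraNneq xS => ->.
    have /negPf-> : x != a by apply: contraNneq xS => ->.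
    have /negPf-> : x != b by apply: contraNneq xS => ->.
    by rewrite (out_perm sS) // !inE (negPf xS) andbF.
  apply/forallP => x; rewrite permM cycle3E //.
  case: eqVneq => [->//|_]; case: eqVneq => [->//|_].
  by case: eqVneq => [->|_]; rewrite ?sfix.
pose Q s := [set p | ok s p].
have -> : #|P| = \sum_(s in valid_perms E (S :\ u)) #|Q s|.
  rewrite -sum1_card (eq_bigr (fun s => \sum_(p in Q s) 1)); last first.
    by move=> s _; rewrite sum1_card.
  rewrite pair_big_dep /=; apply: eq_bigl => x; rewrite !inE; congr (_ && _).
rewrite -sum_nat_const; apply: leq_sum => s /[!inE] /andP[sSu /forallP Es].
have sS : perm_on S s by apply: perm_on_sub sSu; rewrite subD1set.
pose A := [set a in S | E u (s a)] :\ u.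
pose B a := ([set b in S | E a (s b)] :&: [set b in S | E b u]) :\ u :\ a.
have QE : #|Q s| = \sum_(a in A) #|B a|.
  rewrite -sum1_card (eq_bigr (fun a => \sum_(b in B a) 1)); last first.
    by move=> a _; rewrite sum1_card.
  rewrite pair_big_dep /=; apply: eq_bigl => -[a b]; rewrite !inE /ok /=.
  rewrite ![_ == u]eq_sym ![b == _]eq_sym.
  by do !case: (_ \in _); do !case: (_ == _); rewrite ?andbT ?andbF.
(* Removing [u] turns [D] into [D.-1]. For [b], two subsets of [S] of size at least [D] meet in at
   least [2 * D - #|S|] points, and removing [u] and [a] costs 2 more. *)
have Age : D.-1 <= #|A|.
  have /andP[+ _] := degS u uS; rewrite /outdeg -(card_preim_perm_on _ sS).
  rewrite (cardsD1 u [set j in S | _]) -/A; case: (_ \in _); lia.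
rewrite QE; apply: leq_trans (leq_mul Age (leqnn _)) _.
rewrite -sum_nat_const; apply: leq_sum => a; rewrite !inE => /and3P[_ aS _].
have /andP[+ _] := degS a aS; rewrite /outdeg -(card_preim_perm_on _ sS).
have /andP[_] := degS u uS; rewrite /indeg.
set B2 := [set i in S | E i u]; set B1 := [set j in S | _].
have := @cardI_ge _ B1 B2 S.
have -> : B1 \subset S by apply/subsetP => x /[!inE] /andP[].
have -> : B2 \subset S by apply/subsetP => x /[!inE] /andP[].
move=> /(_ isT isT).
have := cardsD1 u (B1 :&: B2); have := cardsD1 a ((B1 :&: B2) :\ u).
rewrite /B -/B1 -/B2.
move: (#|_ :\ a|) (#|_ :\ u|) (#|B1 :&: B2|).
by do 2!case: (_ \in _); lia.
Qed.

(** In a permutation with the most good indices, a bad index [a] could be repaired by rerouting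
    along a transposition or a 3-cycle without spoiling any other index. *)
Lemma exists_valid_perm (T : finType) (E : rel T) (D : nat) :
  min_semidegree E setT D -> #|T| < 2 * D ->
  exists s : {perm T}, forall i, E i (s i).
Proof.
move=> degE D_gt.
have out i : D <= outdeg E setT i by have /andP[] := degE i (in_setT i).
have inn i : D <= indeg E setT i by have /andP[] := degE i (in_setT i).
pose good (s : {perm T}) := [set i | E i (s i)].
have [s _ smax] := @arg_maxnP _ (1%g : {perm T}) xpredT (fun s => #|good s|) isT.
exists s => a; apply: contraT => nEa.
suff [t st at_] : exists2 t, good s \subset good t & a \in good t.
  have : good s \proper good t.
    rewrite properE st; apply/subsetPn; exists a => //.
    by rewrite inE.
  by move=> /proper_card; rewrite ltnNge => /negP[]; exact: smax.
have sT : perm_on setT s by apply/subsetP.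
have /card_gt0P[b] : 0 < #|[set j in setT | E a (s j)]|.
  rewrite (card_preim_perm_on _ sT); have := out a; rewrite /outdeg; lia.
rewrite !inE /= => Eab.
(* Both sets have at least [D] elements and [2 * D] exceeds [#|T|]. The case [c = b] can occur and
   gives the transposition. *)
have /card_gt0P[c] : 0 < #|[set j in setT | E b (s j)] :&: [set i in setT | E i (s a)]|.
  apply: leq_trans (cardI_ge (subsetT _) (subsetT _)).
  rewrite (card_preim_perm_on _ sT) cardsT.
  by have := out b; have := inn (s a); rewrite /outdeg /indeg; lia.
rewrite !inE /= => /andP[Ebc Eca].
have ab : a != b by apply: contraNneq nEa => eab; rewrite {2}eab.
have ac : a != c by apply: contraNneq nEa => eac; rewrite {1}eac.
have [bc|bc] := eqVneq b c.
  exists (tperm a b * s)%g; last by rewrite inE permM tpermL.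
  apply/subsetP => x; rewrite !inE permM.
  by case: tpermP => // -> _; rewrite // bc.
exists (cycle3 a b c * s)%g; last by rewrite inE permM cycle3E // eqxx.
apply/subsetP => x; rewrite !inE permM cycle3E //.
do 3!case: eqVneq => [->//|_]; done.
Qed.

(** * Exponential lower bound on the number of matchings *)

(** The number of pairs of a vertex of [S] and an injective [j]-tuple of its [F]-out-neighbours in
    [S]. *)
Definition ffact_degree_sum (T : finType) (F : rel T) (j : nat) (S : {set T}) :
    nat :=
  \sum_(v in S) (outdeg F S v) ^_ j.

(* The falling factorial counts the injective j-tuples of N, and such a tuple
   survives the deletion of u unless it contains u. *)
Lemma sum_ffact_setD1 (T : finType) (N S : {set T}) (v : T) (j : nat) :
  N \subset S -> v \in S -> v \notin N ->
  \sum_(u in S :\ v) #|N :\ u| ^_ j = (#|S|.-1 - j) * #|N| ^_ j.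
Proof.
move=> NS vS vN.
rewrite (bigID [in N]) /=.
rewrite (eq_bigl [in N]); last first.
  move=> u; rewrite !inE; have [uN|] := boolP (u \in N); last by rewrite andbF.
  by rewrite (subsetP NS) // !andbT; apply: contraNneq vN => <-.
rewrite (eq_bigr (fun=> #|N|.-1 ^_ j)); last first.
  by move=> u uN; rewrite (cardsD1 u N) uN.
rewrite sum_nat_const.
rewrite (eq_bigr (fun=> #|N| ^_ j)); last first.
  by move=> u /andP[_ uN]; rewrite (cardsD1 u N) (negPf uN).
rewrite sum_nat_const.
have -> : #|[pred i in S :\ v | i \notin N]| = #|S|.-1 - #|N|.
  rewrite (cardsD1 v S) vS add1n /=.
  have /setIidPr {2}<- : N \subset S :\ v by rewrite subsetD1 NS.
  by rewrite -cardsD; apply: eq_card => x; rewrite !inE andbC.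
have NS1 : #|N| <= #|S|.-1.
  rewrite (cardsD1 v S) vS add1n /= subset_leq_card // subsetD1 NS //.
have -> : #|N| * #|N|.-1 ^_ j = #|N| ^_ j * (#|N| - j).
  by rewrite -ffactnSr; case: (#|N|) => [|m]; rewrite ?ffactnS // mul0n ffact0n.
have [jN|/ffact_small->] := leqP j #|N|; last by rewrite mul0n !muln0.
rewrite mulnC -mulnDl; congr (_ * _); lia.
Qed.

(** By irreflexivity a counted pair involves [j + 1] distinct points, so it survives the deletion of
    each of the remaining [#|S| - 1 - j] points. *)
Lemma sum_ffact_degree_sum (T : finType) (F : rel T) (j : nat) (S : {set T}) :
  irreflexive F ->
  \sum_(u in S) ffact_degree_sum F j (S :\ u)
    = (#|S|.-1 - j) * ffact_degree_sum F j S.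
Proof.
move=> Firr; rewrite /ffact_degree_sum big_distrr /=.
rewrite (exchange_big_dep [in S]) /=; last by move=> u v _ /setD1P[].
apply: eq_bigr => v vS.
rewrite -(@sum_ffact_setD1 _ [set w in S | F v w] _ v) //; first last.
- by rewrite inE Firr andbF.
- by apply/subsetP => x /[!inE] /andP[].
apply: eq_big => [u|u]; first by rewrite !inE vS andbT andbC eq_sym.
move=> _; congr (_ ^_ _); apply: eq_card => x; rewrite !inE ?andbA //.
Qed.

(** This is [(1 - j / M) * (1 + 1 / M) ^ j <= 1] cleared of denominators. With [M + 1 = #|S|] it
    weighs the tuples lost in a deletion against the smaller denominator of the potential. *)
Lemma weight_decay (M j : nat) : (M - j) * M.+1 ^ j <= M ^ j.+1.
Proof.
elim: j => [|j IH]; first by rewrite subn0 expn0 expn1 muln1.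
apply: leq_trans (_ : (M - j) * M.+1 ^ j * M <= _).
  rewrite [X in _ <= X]mulnAC expnS mulnA leq_mul2r.
  apply/orP; right; nia.
by rewrite (expnS _ j.+1) [M * _]mulnC leq_mul2r IH orbT.
Qed.

Local Open Scope ring_scope.

(* Up to constants, the k-th summand bounds the expected number of vertices with
   more than k / r non-neighbours left when S has been shrunk at random to k
   elements: Markov's inequality is applied to a falling factorial of order
   J k, and the last quotient is a supermartingale by [weight_decay]. *)
Definition potential (R : realFieldType) (T : finType) (F : rel T) (r : R)
    (J : nat -> nat) (K : nat) (S : {set T}) : R :=
  \sum_(K <= k < #|S|.+1) k%:R * r ^+ J k *
    (ffact_degree_sum F (J k) S
      + ffact_degree_sum (fun x y => F y x) (J k) S)%:R / #|S|%:R ^+ (J k).+1.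

Section Potential.
Variables (R : realFieldType) (T : finType) (F : rel T).
Variables (r : R) (J : nat -> nat) (K : nat).
Hypotheses (r0 : 0 <= r) (Firr : irreflexive F).

Let pot := potential F r J K.

(** The average of [pot (S :\ u)] over [u] is at most [pot S], and some [u] does no worse than the
    average. *)
Lemma potential_setD1 (S : {set T}) : (0 < #|S|)%N ->
  exists2 u, u \in S & pot (S :\ u) <= pot S.
Proof.
move=> S0; apply/exists_inP; apply: contraT => /exists_inPn noS.
have /card_gt0P[u0 u0S] := S0.
suff : \sum_(u in S) pot (S :\ u) <= \sum_(u in S) pot S.
  rewrite leNgt => /negP[]; apply: ltr_sum.
    by apply/hasP; exists u0; rewrite ?mem_index_enum.
  by move=> u uS; rewrite ltNge; exact: noS.
rewrite sumr_const -mulr_natl /pot /potential mulr_sumr.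
rewrite (eq_bigr (fun u => \sum_(K <= k < #|S|) k%:R * r ^+ J k *
    (ffact_degree_sum F (J k) (S :\ u)
      + ffact_degree_sum (fun x y => F y x) (J k) (S :\ u))%:R
        / (#|S|.-1)%:R ^+ (J k).+1)); last first.
  by move=> u uS; rewrite (cardsD1 u S) uS.
rewrite exchange_big /=.
set m := #|S|.
apply: (@le_trans _ _ (\sum_(K <= k < m) m%:R * (k%:R * r ^+ J k *
    (ffact_degree_sum F (J k) S
      + ffact_degree_sum (fun x y => F y x) (J k) S)%:R / m%:R ^+ (J k).+1))).
  apply: ler_sum => k _; rewrite -mulr_suml -mulr_sumr -natr_sum.
  rewrite big_split /= !sum_ffact_degree_sum // -mulnDr.
  set Q := (_ + _)%N; rewrite -/m natrM.
  have -> : m%:R * (k%:R * r ^+ J k * Q%:R / m%:R ^+ (J k).+1)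
         = k%:R * r ^+ J k * Q%:R / m%:R ^+ (J k).
    by rewrite exprS; field; rewrite expf_neq0 // pnatr_eq0 -lt0n S0.
  rewrite -!mulrA ler_wpM2l ?ler0n // ler_wpM2l ?exprn_ge0 //.
  rewrite mulrCA ler_wpM2l ?ler0n //.
  have [m1|m1] := posnP m.-1.
    by rewrite m1 sub0n mul0r invr_ge0 exprn_ge0 ?ler0n.
  rewrite ler_pdivrMr ?exprn_gt0 ?ltr0n // mulrC ler_pdivlMr ?exprn_gt0 ?ltr0n //.
  rewrite -!natrX -natrM ler_nat.
  by have := weight_decay m.-1 (J k); rewrite prednK.
(* Compared with [S :\ u], the potential of [S] has the additional nonnegative summand [k = m]. *)
have [Km|mK] := leqP K m; last by rewrite !big_geq // ltnW.
rewrite [leRHS]big_nat_recr //= lerDl !mulr_ge0 ?exprn_ge0 ?invr_ge0 ?exprn_ge0 //.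
Qed.

(** Only the summand [k = #|S|] is kept, whose factor [k] cancels one power of the denominator, and
    in it only the contribution of [v]. *)
Lemma potential_ge (S : {set T}) (v : T) :
  (K <= #|S|)%N -> v \in S ->
  (r / #|S|%:R) ^+ J #|S| * (outdeg F S v ^_ J #|S| + indeg F S v ^_ J #|S|)%:R
    <= pot S.
Proof.
move=> KS vS; rewrite /pot /potential; set m := #|S|.
have m0 : (0 < m)%N by apply/card_gt0P; exists v.
rewrite big_nat_recr //= -[leLHS]add0r lerD //.
  apply: sumr_ge0 => k _.
  by rewrite !mulr_ge0 ?exprn_ge0 ?invr_ge0 ?exprn_ge0.
rewrite exprS.
set Q := (_ + _)%N; set q := (_ + _)%N.
have -> : m%:R * r ^+ J m * q%:R / (m%:R * m%:R ^+ J m)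
     = (r / m%:R) ^+ J m * q%:R.
  rewrite expr_div_n; field; rewrite ?expf_neq0 pnatr_eq0 -lt0n m0 //.
rewrite ler_wpM2l ?exprn_ge0 ?divr_ge0 //.
rewrite ler_nat leq_add // /ffact_degree_sum (bigD1 v) //= leq_addr //.
Qed.

End Potential.

(** Bernoulli's inequality bounds [i * rho ^ i], hence [k * rho ^ (k %/ L)] by a constant [B].
    Cubing, the purpose of the exponent 3, bounds the summand by [2 * B ^ 3 / k ^ 2], and
    [1 / k ^ 2 <= 1 / (k - 1) - 1 / k] telescopes. The doubling accounts for out- and indegrees. *)
Lemma geometric_tail (R : archiRealFieldType) (rho : R) (L : nat) :
  0 <= rho < 1 -> (0 < L)%N ->
  exists K0 : nat, forall K n : nat, (K0 <= K)%N ->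
    \sum_(K <= k < n) k%:R * rho ^+ (3 * (k %/ L)) *+ 2 < 1.
Proof.
move=> /andP[rho0 rho1] L0.
set h := 1 - rho; have h0 : 0 < h by rewrite subr_gt0.
set B : R := 2 * L%:R / h.
have B0 : 0 < B by rewrite divr_gt0 // mulr_gt0 // ltr0n.
have B3 : 0 <= 2 * B ^+ 3 by rewrite mulr_ge0 // exprn_ge0 // ltW.
have rho_le i : rho ^+ i * (i%:R * h) <= 1.
  have b : 1 + h *+ i <= (1 + h) ^+ i.
    elim: i => [|i IH]; first by rewrite mulr0n addr0.
    rewrite exprS; apply: le_trans (ler_wpM2l _ IH); last by rewrite addr_ge0 // ltW.
    rewrite mulrS; have : 0 <= h * (h *+ i) by rewrite mulr_ge0 ?mulrn_wge0 // ltW.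
    by nra.
  apply: (@le_trans _ _ (rho ^+ i * (1 + h) ^+ i)).
    rewrite ler_wpM2l ?exprn_ge0 //; rewrite mulr_natl; lra.
  rewrite -exprMn exprn_ile1 //; rewrite /h; nra.
have term k : (L <= k)%N -> (1 < k)%N ->
    k%:R * rho ^+ (3 * (k %/ L)) *+ 2 <= 2 * B ^+ 3 * ((k.-1)%:R^-1 - k%:R^-1).
  move=> Lk k1; set i := (k %/ L)%N.
  have k0 : 0 < k%:R :> R by rewrite ltr0n ltnW.
  have ki : k%:R <= 2 * L%:R * i%:R :> R.
    rewrite -!natrM ler_nat /i.
    have := divn_eq k L; have := ltn_pmod k L0.
    have : (1 <= k %/ L)%N by rewrite divn_gt0.
    nia.
  have kB : k%:R * rho ^+ i <= B.
    rewrite /B ler_pdivlMr //.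
    apply: (@le_trans _ _ (2 * L%:R * (rho ^+ i * (i%:R * h)))).
      rewrite mulrAC.
      have -> : 2 * L%:R * (rho ^+ i * (i%:R * h)) = 2 * L%:R * i%:R * h * rho ^+ i.
        by ring.
      by rewrite ler_wpM2r ?exprn_ge0 // ler_wpM2r // ltW.
    by rewrite -[leRHS]mulr1 ler_wpM2l // mulr_ge0.
  have k1k : (k.-1)%:R = k%:R - 1 :> R by rewrite -subn1 natrB // ltnW.
  have k1' : 1 < k%:R :> R by rewrite ltr1n.
  have -> : k%:R * rho ^+ (3 * i) *+ 2 = 2 * (k%:R * rho ^+ i) ^+ 3 / k%:R ^+ 2.
    by rewrite mulnC exprM -mulr_natl; field; apply: lt0r_neq0.
  apply: (@le_trans _ _ (2 * B ^+ 3 / k%:R ^+ 2)).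
    rewrite ler_wpM2r ?invr_ge0 ?exprn_ge0 ?ler0n // ler_wpM2l //.
    by apply: lerXn2r; rewrite // nnegrE ?(ltW B0) // mulr_ge0 // exprn_ge0.
  rewrite ler_wpM2l //.
  rewrite k1k -subr_ge0.
  have -> : (k%:R - 1)^-1 - k%:R^-1 - (k%:R ^+ 2)^-1
     = ((k%:R - 1) * k%:R ^+ 2)^-1 :> R.
    by field; apply/andP; split; apply: lt0r_neq0 => //; lra.
  by rewrite invr_ge0 mulr_ge0 ?exprn_ge0 ?ltW // subr_gt0.
pose M := Num.truncn (2 * B ^+ 3).
exists (maxn L M.+3) => K n; rewrite geq_max => /andP[LK MK].
have [nK|Kn] := leqP n K; first by rewrite big_geq.
apply: (@le_lt_trans _ _
   (\sum_(K <= k < n) 2 * B ^+ 3 * ((k.-1)%:R^-1 - k%:R^-1))).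
  by rewrite !big_nat; apply: ler_sum => k /andP[Kk _]; apply: term; lia.
rewrite -mulr_sumr.
have tele : \sum_(K <= k < n) ((k.-1)%:R^-1 - k%:R^-1) <= (K.-1)%:R^-1 :> R.
  have -> : \sum_(K <= k < n) ((k.-1)%:R^-1 - k%:R^-1)
     = (K.-1)%:R^-1 - (n.-1)%:R^-1 :> R.
    elim: n Kn => // n IH; rewrite ltnS leq_eqVlt => /predU1P[<-|Kn].
      by rewrite big_nat1.
    rewrite big_nat_recr /=; last exact: ltnW.
    by rewrite IH //; ring.
  by rewrite gerBl invr_ge0.
apply: le_lt_trans (ler_wpM2l _ tele) _; first exact: B3.
rewrite ltr_pdivrMr ?ltr0n; last by lia.
rewrite mul1r; apply: lt_le_trans (truncnS_gt _) _.
rewrite ler_nat; suff : (M < K.-1)%N by []; lia.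
Qed.

Lemma le_exp_ffact (x y j : nat) : (y + j <= x)%N -> (y ^ j <= x ^_ j)%N.
Proof.
elim: j => // j IH yx; rewrite expnSr ffactnSr leq_mul ?IH //; lia.
Qed.

Lemma ffact_le_exp (x j : nat) : (x ^_ j <= x ^ j)%N.
Proof. by elim: j => // j IH; rewrite expnSr ffactnSr leq_mul // leq_subr. Qed.

Lemma outdegC (T : finType) (E : rel T) (S : {set T}) (v : T) :
  (outdeg E S v + outdeg (fun x y => ~~ E x y) S v = #|S|)%N.
Proof.
rewrite /outdeg -(cardsID [set w | E v w] S).
by congr (_ + _)%N; apply: eq_card => x; rewrite !inE // andbC.
Qed.

Lemma valid_perms_sub (T : finType) (E : rel T) (A B : {set T}) :
  A \subset B -> valid_perms E A \subset valid_perms E B.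
Proof.
move=> AB; apply/subsetP => s /[!inE] /andP[sA ->].
by rewrite andbT; exact: perm_on_sub sA.
Qed.

(** Real lower bounds [d] and [s] replace the truncated differences of [switching]. *)
Lemma switching_natr (R : realFieldType) (T : finType) (E : rel T)
    (S : {set T}) (u : T) (D : nat) (d s : R) :
  u \in S -> min_semidegree E S D -> 0 <= d -> 0 <= s ->
  d + 1 <= D%:R -> #|S|%:R + s + 2 <= 2 * D%:R ->
  #|valid_perms E (S :\ u)|%:R * (d * s) <= #|valid_perms E S|%:R * #|S|%:R.
Proof.
move=> uS degS d0 s0 dD sD.
apply: (@le_trans _ _ (#|valid_perms E (S :\ u)| *
                        (D.-1 * (2 * D - #|S| - 2)))%:R); last first.
  by rewrite -natrM ler_nat; exact: switching.
rewrite natrM ler_wpM2l ?ler0n // natrM.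
have D1 : (1 <= D)%N by rewrite -(ler_nat R); lra.
have D2 : (#|S| + 2 <= 2 * D)%N by rewrite -(ler_nat R) natrD natrM; lra.
rewrite -subnDA natrB // natrM natrD -subn1 natrB //.
by rewrite ler_pM //; lra.
Qed.

(** Each deletion from a set of [m] points in the chain contributes a factor [c * m]; these multiply
    to the bound. *)
Lemma valid_perms_exp_lower (R : archiRealFieldType) (eps : R) :
  0 < eps -> eps <= 2^-1 ->
  exists2 c : R, 0 < c <= 1 &
  forall (T : finType) (E : rel T) (D : nat), reflexive E ->
    min_semidegree E setT D -> (2^-1 + eps) * #|T|%:R <= D%:R ->
    c ^+ #|T| * (#|T|`!)%:R <= #|valid_perms E setT|%:R.
Proof.
move=> eps0 eps1.
(* Chosen so that [J k <= eps * k / 8], with [J k] still growing linearly. *)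
pose L := (Num.truncn (24 / eps)).+1.
have L_ge : 24 <= eps * L%:R.
  by rewrite mulrC -ler_pdivrMr // ltW // truncnS_gt.
pose J k := (3 * (k %/ L))%N.
have J_le k : (J k)%:R <= eps * k%:R / 8.
  rewrite ler_pdivlMr // /J natrM.
  have : (k %/ L * L)%N%:R <= k%:R :> R by rewrite ler_nat leq_divM.
  rewrite natrM => /(ler_wpM2l (ltW eps0)).
  have := ler_wpM2r (ler0n R (k %/ L)) L_ge; lra.
(* If [X] is at least [(1/2 - eps/2) * k], then [X - J k] is at least [t * k], so the falling
   factorial of [X] is at least [(t * k) ^ J k]. The initial density [1/2 - eps] of non-neighbours
   is below [t], which makes the tail geometric. *)
pose t := 2^-1 - 5 / 8 * eps; have t0 : 0 < t by rewrite /t; lra.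
have rho01 : 0 <= t^-1 * (2^-1 - eps) < 1.
  rewrite mulr_ge0 ?invr_ge0 /=; [|exact: ltW|lra].
  by rewrite mulrC ltr_pdivrMr // mul1r /t; lra.
have [K0 tail] := @geometric_tail R _ L rho01 isT.
pose K := (K0 + (Num.truncn (8 / eps)).+1)%N.
have K_ge : 8 <= eps * K%:R.
  rewrite mulrC -ler_pdivrMr // ltW //; apply: lt_le_trans (truncnS_gt _) _.
  by rewrite ler_nat leq_addl.
have K0R : 0 < K%:R :> R by rewrite ltr0n /K addnS.
(* [eps / 4] is the gain of a switching. [1 / K] makes [c * m <= 1] for [m < K], where monotonicity
   of the count suffices. *)
pose c := Num.min (eps / 4) (K%:R^-1).
have c0 : 0 < c by rewrite lt_min divr_gt0 //= invr_gt0.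
have c_le : c <= eps / 4 by rewrite ge_min lexx.
have cK : c * K%:R <= 1.
  by rewrite -ler_pdivlMr // div1r ge_min lexx orbT.
exists c; first by rewrite c0 /=; lra.
move=> T E D Erefl degE D_ge.
pose F x y := ~~ E x y.
have Firr : irreflexive F by move=> x; rewrite /F Erefl.
have r0 : 0 <= t^-1 by rewrite invr_ge0 ltW.
pose pot S := potential F t^-1 J K S.
have step : forall m (S : {set T}), #|S| = m -> pot S < 1 ->
    c ^+ m * m`!%:R <= #|valid_perms E S|%:R.
  elim=> [|m IH] S Sm pot1.
    rewrite expr0 fact0 mulr1 ler1n; apply/card_gt0P; exists 1%g.
    rewrite inE; apply/andP; split; first by apply/subsetP => x; rewrite inE perm1 eqxx.
    by apply/forallP => x; rewrite perm1.
  have [u uS potu] : exists2 u, u \in S & pot (S :\ u) <= pot S.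
    by apply: potential_setD1; rewrite // Sm.
  have Sum : #|S :\ u| = m by move: Sm; rewrite (cardsD1 u) uS => -[].
  have {}IH := IH _ Sum (le_lt_trans potu pot1).
  rewrite exprS factS natrM.
  have -> : c * c ^+ m * (m.+1%:R * m`!%:R) = c * m.+1%:R * (c ^+ m * m`!%:R).
    by ring.
  apply: (@le_trans _ _ (c * m.+1%:R * #|valid_perms E (S :\ u)|%:R)).
    by rewrite ler_wpM2l // mulr_ge0 // ltW.
  have [mK|Km] := ltnP m.+1 K.
    apply: (@le_trans _ _ #|valid_perms E (S :\ u)|%:R).
      rewrite ler_piMl //; apply: le_trans cK.
      by rewrite ler_wpM2l ?ler_nat; [|exact: ltW|exact: ltnW].
    by rewrite ler_nat subset_leq_card // valid_perms_sub // subD1set.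
  rewrite -Sm in Km *; set M := #|S| in Km *.
  have M0 : 0 < M%:R :> R by rewrite /M Sm ltr0n.
  have M_ge : 8 <= eps * M%:R.
    by apply: le_trans K_ge _; rewrite ler_wpM2l ?ler_nat // ltW.
  pose x := (2^-1 - eps / 2) * M%:R.
  have x0 : 0 <= x by rewrite mulr_ge0 //; lra.
  (* Otherwise the summand k = M of the potential would be at least 1. *)
  have small X : (t^-1 / M%:R) ^+ J M * (X ^_ J M)%:R < 1 -> X%:R < x.
    apply: contraTT; rewrite -!leNgt => xX.
    have JX : (J M <= X)%N.
      by rewrite -(ler_nat R) (le_trans (J_le M)) // (le_trans _ xX) // /x; nra.
    apply: (@le_trans _ _ ((t^-1 / M%:R) ^+ J M * ((X - J M) ^ J M)%N%:R)).
      rewrite natrX -exprMn exprn_ege1 // natrB //.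
      rewrite -mulrA mulrC ler_pdivlMr // mul1r mulrC ler_pdivlMr //.
      have := J_le M; move: xX; rewrite /x /t; nra.
    rewrite ler_wpM2l ?exprn_ge0 ?divr_ge0 // ler_nat le_exp_ffact //.
    by rewrite subnK.
  pose X0 := Num.truncn x.
  have X0x : X0%:R <= x by rewrite truncn_le.
  have X0M : (X0 <= M)%N.
    by rewrite -(ler_nat R) (le_trans X0x) // /x; nra.
  have degS : min_semidegree E S (M - X0).
    move=> v vS; have := @potential_ge _ _ F t^-1 J K r0 S v Km vS.
    rewrite -/M -/(pot S) natrD mulrDr => /le_lt_trans /(_ pot1) lt1.
    have ge0 X : 0 <= (t^-1 / M%:R) ^+ J M * (X ^_ J M)%:R.
      by rewrite mulr_ge0 ?exprn_ge0 ?divr_ge0.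
    have Xle X : (t^-1 / M%:R) ^+ J M * (X ^_ J M)%:R < 1 -> (X <= X0)%N.
      by move=> /small Xx; rewrite /X0 truncn_ge_nat // ltW.
    have /Xle o : (t^-1 / M%:R) ^+ J M * (outdeg F S v ^_ J M)%:R < 1.
      by apply: le_lt_trans lt1; rewrite lerDl.
    have /Xle i : (t^-1 / M%:R) ^+ J M * (indeg F S v ^_ J M)%:R < 1.
      by apply: le_lt_trans lt1; rewrite lerDr.
    have := outdegC E S v; have := outdegC (fun a b => E b a) S v.
    rewrite -/M -/F.
    have -> : outdeg (fun x y => ~~ E y x) S v = indeg F S v by [].
    have -> : outdeg (fun x y => E y x) S v = indeg E S v by [].
    move=> /(canRL (addnK _)) -> /(canRL (addnK _)) ->.
    by rewrite !leq_sub2l.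
  have MX : (M - X0)%:R = M%:R - X0%:R :> R by rewrite natrB.
  (* Here [M - X0 >= (1/2 + eps/2) * M], and [eps * M >= 8] absorbs the additive constants 1 and
     2. *)
  have := @switching_natr R T E S u (M - X0) (M%:R / 2) (eps * M%:R / 2) uS degS.
  rewrite -/M MX => sw.
  suff: #|valid_perms E (S :\ u)|%:R * (M%:R / 2 * (eps * M%:R / 2))
        <= #|valid_perms E S|%:R * M%:R.
    set N := #|_|%:R; set N' := #|_|%:R.
    have -> : N * (M%:R / 2 * (eps * M%:R / 2)) = (eps / 4 * M%:R * N) * M%:R.
      by field.
    rewrite ler_pM2r // => /(le_trans _); apply.
    by rewrite ler_wpM2r ?ler0n // ler_wpM2r // ltW.
  by apply: sw; move: X0x; rewrite /x ?mulr_ge0 ?divr_ge0 //; nra.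
(* The potential of [setT] remains to be bounded. All non-degrees are at most [(1/2 - eps) * #|T|],
   so its summands are dominated by those of [tail]. *)
apply: step; first by rewrite cardsT.
rewrite /pot /potential cardsT.
have p0 : 0 <= 2^-1 - eps by lra.
(* If [T] is empty, the convention that 0 has inverse 0 makes every summand vanish. *)
have [T0|T0] := posnP #|T|.
  rewrite T0 big1 ?ltr01 // => k _.
  by rewrite exprS mul0r invr0 mulr0.
apply: le_lt_trans (tail K #|T|.+1 (leq_addr _ _)).
apply: ler_sum => k _.
rewrite -/(J k) -!mulrA -mulrnAr ler_wpM2l // exprMn -mulrnAr.
rewrite ler_wpM2l ?exprn_ge0 //.
rewrite ler_pdivrMr ?exprn_gt0 ?ltr0n //.
have bound (H : rel T) : (forall v, (outdeg H setT v)%:R <= (2^-1 - eps) * #|T|%:R) ->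
    (ffact_degree_sum H (J k) setT)%:R
      <= (2^-1 - eps) ^+ J k * #|T|%:R ^+ (J k).+1.
  move=> Hd; rewrite /ffact_degree_sum natr_sum.
  apply: (@le_trans _ _ (\sum_(v in [set: T]) ((2^-1 - eps) * #|T|%:R) ^+ J k)).
    apply: ler_sum => v _.
    apply: (@le_trans _ _ ((outdeg H setT v)%:R ^+ J k)).
      by rewrite -natrX ler_nat ffact_le_exp.
    by apply: lerXn2r; rewrite ?nnegrE // mulr_ge0.
  by rewrite sumr_const cardsT -mulr_natl exprMn exprS; lra.
rewrite natrD mulrnAl mulr2n lerD // bound // => v.
  have := outdegC E setT v; rewrite cardsT -/F => /(congr1 (fun n => n%:R : R)).
  rewrite natrD.
  have /andP[+ _] := degE v (in_setT v); rewrite -(ler_nat R); move: D_ge; lra.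
have := outdegC (fun a b => E b a) setT v; rewrite cardsT.
move=> /(congr1 (fun n => n%:R : R)); rewrite natrD.
have /andP[_] := degE v (in_setT v); rewrite -(ler_nat R); move: D_ge.
rewrite /indeg /outdeg /F; lra.
Qed.

(** * Spread of uniform matchings *)

(** Bernoulli's inequality gives [(m / (m + 1)) ^ h >= 1 - h / (m + 1) >= 1/2] for
    [h <= (m + 1) / 2]; it is applied to both halves of [q]. *)
Lemma succ_exp_le (m q : nat) : (q <= m -> m.+1 ^ q <= 4 * m ^ q)%N.
Proof.
move=> qm.
have bernoulli h : (m.+1 ^ h * (m.+1 - h) <= m.+1 * m ^ h)%N.
  elim: h => [|h IH]; first by rewrite !expn0 mul1n muln1 subn0.
  apply: (@leq_trans (m.+1 ^ h * (m.+1 - h) * m)%N).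
    by rewrite expnSr -!mulnA leq_mul2l; apply/orP; right; nia.
  by rewrite expnSr [leqRHS]mulnA leq_mul2r IH orbT.
have half h : (h.*2 <= m.+1 -> m.+1 ^ h <= 2 * m ^ h)%N.
  move=> hm; rewrite -(leq_pmul2l (ltn0Sn m)) mulnA [(_ * 2)%N]mulnC -mulnA.
  apply: leq_trans (leq_mul (leqnn 2) (bernoulli h)).
  by rewrite mulnCA [leqLHS]mulnC leq_mul2l; apply/orP; right; lia.
have -> : q = (uphalf q + q./2)%N by rewrite uphalf_half; lia.
rewrite !expnD -[4%N]/(2 * 2)%N mulnACA leq_mul // half //; lia.
Qed.

Lemma exp_le_ffact (n q : nat) : (q <= n -> n ^ q <= 4 ^ q * n ^_ q)%N.
Proof.
elim: q n => [//|q IH] [//|n] qn.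
rewrite ffactSS !expnS -mulnA [X in (_ <= 4 * X)%N]mulnCA mulnCA.
rewrite leq_mul2l; apply/orP; right.
apply: leq_trans (@succ_exp_le n q qn) _.
by rewrite leq_mul2l IH.
Qed.

Lemma fact_sub_exp_le (R : realFieldType) (n q : nat) : (q <= n)%N ->
  (n - q)`!%:R * (n%:R / 4) ^+ q <= n`!%:R :> R.
Proof.
move=> qn; rewrite expr_div_n mulrA ler_pdivrMr ?exprn_gt0 //.
rewrite -!natrX -!natrM ler_nat -(ffact_fact qn) mulnAC mulnC.
by rewrite leq_mul2r [(n ^_ q * _)%N]mulnC exp_le_ffact ?orbT.
Qed.

Lemma card_perm_agree (T : finType) (I : {set T}) (f0 : {perm T}) :
  #|[set f : {perm T} | [forall i in I, f i == f0 i]]| = (#|T| - #|I|)`!.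
Proof.
have -> : (#|T| - #|I|)%N = #|~: I| by rewrite [RHS]cardsCs setCK.
rewrite -card_perm -[RHS](card_imset _ (@mulIg _ f0)); apply: eq_card => f.
apply/idP/imsetP => [|[g gI ->]]; rewrite inE.
  move=> /forall_inP fI; exists (f * f0^-1)%g; last by rewrite mulgKV.
  apply/subsetP => x; rewrite !inE permM; apply: contraNN => /fI /eqP->.
  by rewrite permK.
apply/forall_inP => x xI.
by rewrite permM (out_perm gI) // inE xI.
Qed.

Lemma min_semidegree_setC (T : finType) (E : rel T) (D : nat) (A : {set T}) :
  min_semidegree E setT D -> min_semidegree E (~: A) (D - #|A|).
Proof.
move=> degE v _.
have le (P : pred T) : (#|[set j in setT | P j]| - #|A| <= #|[set j in ~: A | P j]|)%N.
  rewrite leq_subLR; apply: leq_trans (leq_card_setU _ _).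
  by apply: subset_leq_card; apply/subsetP => x; rewrite !inE; case: (x \in A).
have /andP[o i] := degE v (in_setT v).
by rewrite !(leq_trans (leq_sub2r _ _) (le _)).
Qed.

Lemma valid_perms_setC (R : archiRealFieldType) (eps : R) :
  0 < eps -> eps <= 2^-1 ->
  exists2 c : R, 0 < c &
  exists n0 : nat, forall (T : finType) (E : rel T) (D : nat), reflexive E ->
    min_semidegree E setT D -> (n0 <= #|T|)%N ->
    (2^-1 + eps) * #|T|%:R <= D%:R ->
    forall A : {set T},
      #|valid_perms E (~: A)|%:R * (c * #|T|%:R) ^+ #|A|
        <= #|valid_perms E setT|%:R.
Proof.
move=> eps0 eps1.
have [c /andP[c0 c1] lower] := valid_perms_exp_lower eps0 eps1.
pose M := (Num.truncn (2 / eps)).+1.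
have M_ge : 2 <= eps * M%:R.
  by rewrite mulrC -ler_pdivrMr // ltW // truncnS_gt.
pose n0 := (Num.truncn (4 / eps)).+1.
have n0_ge : 4 <= eps * n0%:R.
  by rewrite mulrC -ler_pdivrMr // ltW // truncnS_gt.
(* The first entry is the gain per point for small [A]. The second serves large [A], where
   [n <= M * #|A|] bounds [c ^ n] below by [(c ^ M) ^ #|A|] and the 4 comes from
   [fact_sub_exp_le]. *)
pose C := Num.min (eps / 2) (c ^+ M / 4).
have C0 : 0 < C by rewrite lt_min !divr_gt0 ?exprn_gt0.
exists C => //; exists n0 => T E D Erefl degE Tn0 D_ge A.
set n := #|T| in Tn0 D_ge *.
have n_ge : 4 <= eps * n%:R.
  by apply: le_trans n0_ge _; rewrite ler_wpM2l ?ler_nat // ltW.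
have nR : 0 < n%:R :> R by rewrite ltr0n (leq_trans _ Tn0).
have mono x : C <= x -> #|valid_perms E (~: A)|%:R * (C * n%:R) ^+ #|A| <=
    #|valid_perms E (~: A)|%:R * (x * n%:R) ^+ #|A|.
  move=> Cx; rewrite ler_wpM2l //; apply: lerXn2r; rewrite ?nnegrE.
  - by rewrite mulr_ge0 // ltW.
  - by rewrite mulr_ge0 // (le_trans (ltW C0)).
  - by rewrite ler_wpM2r.
have [A_small|A_large] := lerP #|A|%:R (eps / 2 * n%:R).
  apply: le_trans (mono (eps / 2) _) _; first by rewrite ge_min lexx.
  move Aa : #|A| A_small => a; elim: a A Aa {mono} => [|a IH] A Aa a_le.
    by move/eqP: Aa; rewrite cards_eq0 => /eqP->; rewrite setC0 expr0 mulr1.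
  have /card_gt0P[u uA] : (0 < #|A|)%N by rewrite Aa.
  have Au : #|A :\ u| = a by move: Aa; rewrite (cardsD1 u) uA => -[].
  have a_le' : a%:R <= eps / 2 * n%:R.
    by apply: le_trans a_le; rewrite ler_nat.
  apply: le_trans (IH _ Au a_le').
  have e2 : 0 <= eps / 2 * n%:R by rewrite mulr_ge0 //; lra.
  rewrite exprS mulrA ler_wpM2r ?exprn_ge0 //.
  have uAc : u \in ~: (A :\ u) by rewrite !inE eqxx.
  have aD : (a <= D)%N by rewrite -(ler_nat R); nra.
  have cS : #|~: (A :\ u)|%:R = n%:R - a%:R :> R.
    by rewrite (cardsCs (~: _)) setCK Au natrB // -Au /n max_card.
  (* [2 * (D - a) - (n - a) >= 2 * eps * n - a], which is at least [eps * n + 2] because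
     [a <= eps * n / 2] and [eps * n >= 4]. *)
  have := @switching_natr R T E (~: (A :\ u)) u (D - a) (n%:R / 2) (eps * n%:R) uAc.
  rewrite -{1}Au => /(_ (min_semidegree_setC degE)).
  have -> : ~: (A :\ u) :\ u = ~: A.
    apply/setP => x; rewrite !inE negb_and negbK.
    by case: eqVneq => [->|]; rewrite ?uA.
  rewrite cS natrB // => sw.
  suff: #|valid_perms E (~: A)|%:R * (n%:R / 2 * (eps * n%:R))
        <= #|valid_perms E (~: (A :\ u))|%:R * n%:R.
    set N := #|_|%:R; set N' := #|_|%:R.
    have -> : N * (n%:R / 2 * (eps * n%:R)) = N * (eps / 2 * n%:R) * n%:R.
      by field.
    by rewrite ler_pM2r.
  apply: le_trans (sw _ _ _ _) _; try by nra.
  by rewrite ler_wpM2l // lerBlDr lerDl.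
apply: le_trans (mono (c ^+ M / 4) _) _; first by rewrite ge_min lexx orbT.
have An : (#|A| <= n)%N by rewrite max_card.
have nMA : (n <= M * #|A|)%N.
  rewrite -(ler_nat R) natrM -(ler_pM2l eps0).
  have := ler_wpM2r (ler0n R #|A|) M_ge; move: A_large; nra.
apply: le_trans (lower T E D Erefl degE D_ge); rewrite -/n.
have V_le : #|valid_perms E (~: A)|%:R <= (n - #|A|)`!%:R :> R.
  have -> : (n - #|A|)%N = #|~: A| by rewrite [RHS]cardsCs setCK.
  rewrite ler_nat -card_perm subset_leq_card //.
  by apply/subsetP => s; rewrite !inE => /andP[].
apply: (@le_trans _ _ ((n - #|A|)`!%:R * (c ^+ M / 4 * n%:R) ^+ #|A|)).
  by rewrite ler_wpM2r // exprn_ge0 // mulr_ge0 // divr_ge0 // exprn_ge0 // ltW.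
have -> : c ^+ M / 4 * n%:R = c ^+ M * (n%:R / 4) by ring.
rewrite exprMn mulrCA ler_pM ?mulr_ge0 ?exprn_ge0 ?divr_ge0 //; try exact: ltW.
  by rewrite -exprM; apply: ler_wiXn2l => //; exact: ltW.
exact: fact_sub_exp_le.
Qed.

Definition perfect_matchings (T : finType) (E : rel T) : {set {perm T}} :=
  [set s : {perm T} | [forall i, E i (s i)]].

(** Right multiplication by the inverse of [s0] turns agreement with [s0] on [A] into fixing [A]
    pointwise. *)
Lemma card_matchings_agree (T : finType) (E : rel T) (s0 : {perm T})
    (A : {set T}) :
  #|[set s in perfect_matchings E | [forall i in A, s i == s0 i]]|
    = #|valid_perms (fun i j => E i (s0 j)) (~: A)|.
Proof.
rewrite -[RHS](card_imset _ (@mulIg _ s0)); apply: eq_card => s.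
apply/idP/imsetP => [|[t + ->]]; rewrite !inE.
  move=> /andP[/forallP Es /forall_inP sA].
  exists (s * s0^-1)%g; last by rewrite mulgKV.
  rewrite inE; apply/andP; split; last first.
    by apply/forallP => i; rewrite permM permKV.
  apply/subsetP => x; rewrite !inE permM; apply: contraNN => /sA /eqP->.
  by rewrite permK.
move=> /andP[tA /forallP Et]; apply/andP; split.
  by apply/forallP => i; rewrite permM.
by apply/forall_inP => x xA; rewrite permM (out_perm tA) // inE xA.
Qed.

Lemma matchings_spread (R : archiRealFieldType) (eps : R) :
  0 < eps -> eps <= 2^-1 ->
  exists2 c : R, 0 < c &
  exists n0 : nat, forall (T : finType) (E : rel T) (D : nat),
    min_semidegree E setT D -> (n0 <= #|T|)%N ->
    (2^-1 + eps) * #|T|%:R <= D%:R ->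
    (0 < #|perfect_matchings E|)%N /\
    forall (s0 : {perm T}) (A : {set T}), s0 \in perfect_matchings E ->
      #|[set s in perfect_matchings E | [forall i in A, s i == s0 i]]|%:R
        * (c * #|T|%:R) ^+ #|A| <= #|perfect_matchings E|%:R.
Proof.
move=> eps0 eps1; have [c c0 [n0 spread]] := valid_perms_setC eps0 eps1.
(* The successor makes [T] nonempty, which gives the strict inequality [#|T| < 2 * D]. *)
exists c => //; exists n0.+1 => T E D degE Tn0 D_ge; split.
  have [||s Es] := @exists_valid_perm T E D => //.
    rewrite -(ltr_nat R) natrM; apply: lt_le_trans (ler_wpM2l _ D_ge) => //.
    have : 0 < #|T|%:R :> R by rewrite ltr0n (leq_trans _ Tn0).
    by nra.
  by apply/card_gt0P; exists s; rewrite inE; apply/forallP.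
move=> s0 A; rewrite inE => /forallP Es0.
have -> : #|perfect_matchings E| = #|valid_perms (fun i j => E i (s0 j)) setT|.
  rewrite -setC0 -card_matchings_agree; apply: eq_card => s; rewrite !inE.
  case: (boolP [forall i in set0, _]) => [|/negP[]]; first by rewrite andbT.
  by apply/forall_inP => x; rewrite inE.
rewrite card_matchings_agree.
apply: (spread T _ D) => //; last exact: ltnW.
have s0T : perm_on setT s0 by apply/subsetP.
move=> i _; have /andP[o _] := degE i (in_setT i).
have /andP[_ n] := degE (s0 i) (in_setT _).
by rewrite /outdeg (card_preim_perm_on (E i) s0T) o n.
Qed.

(** [I] and [J] are the labels whose left, respectively right, end is prescribed. Labels in both
    force [s] to agree with [s0] on [f0 @: (I :&: J)]; given [s], the labelling is determined on
    [I :|: J]. The two exponents add up to [#|I| + #|J|]. *)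
Lemma matchings_labelled_spread (R : archiRealFieldType) (eps : R) :
  0 < eps -> eps <= 2^-1 ->
  exists2 c : R, 0 < c &
  exists n0 : nat, forall (T : finType) (E : rel T) (D : nat),
    min_semidegree E setT D -> (n0 <= #|T|)%N ->
    (2^-1 + eps) * #|T|%:R <= D%:R ->
    (0 < #|perfect_matchings E|)%N /\
    forall (f0 s0 : {perm T}) (I J : {set T}), s0 \in perfect_matchings E ->
      #|[set p : {perm T} * {perm T} | [&& p.2 \in perfect_matchings E,
           [forall l in I, p.1 l == f0 l] &
           [forall l in J, p.2 (p.1 l) == s0 (f0 l)]]]|%:R
        * (c * #|T|%:R) ^+ (#|I| + #|J|)
      <= (#|T|`! * #|perfect_matchings E|)%:R.
Proof.
move=> eps0 eps1; have [c1 c10 [n0 spread]] := matchings_spread eps0 eps1.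
pose c := Num.min c1 4^-1.
have c0 : 0 < c by rewrite lt_min c10 invr_gt0 ltr0n.
exists c => //; exists n0 => T E D degE Tn0 D_ge.
have [PM0 {}spread] := spread T E D degE Tn0 D_ge; split=> // f0 s0 I J s0E.
set P := [set p | _]; set n := #|T|.
pose A := f0 @: (I :&: J).
pose V' := [set s in perfect_matchings E | [forall i in A, s i == s0 i]].
have P_le : (#|P| <= #|V'| * (n - #|I :|: J|)`!)%N.
  have -> : #|P| = (\sum_(s in V') #|[set f | (f, s) \in P]|)%N.
    rewrite -sum1_card (eq_bigr (fun s => \sum_(f | (f, s) \in P) 1)%N); last first.
      by move=> s _; rewrite -sum1dep_card.
    rewrite (reindex (fun p : {perm T} * {perm T} => (p.2, p.1))) /=; last first.
      by exists (fun p => (p.2, p.1)) => -[].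
    rewrite pair_big_dep /=; apply: eq_bigl => -[s f] /=.
    case: (boolP ((f, s) \in P)) => [|_]; last by rewrite andbF.
    rewrite andbT !inE /= => /and3P[-> /forall_inP fI /forall_inP fJ] /=.
    apply/esym/forall_inP => _ /imsetP[l /setIP[lI lJ] ->].
    by rewrite -{1}(eqP (fI l lI)) fJ.
  rewrite -sum_nat_const; apply: leq_sum => s _.
  (* All labellings in a nonempty fibre agree with one member [f1] on [I :|: J]; on [J] this uses
     the injectivity of [s]. *)
  have [->|[f1]] := set_0Vmem [set f | (f, s) \in P]; first by rewrite cards0.
  rewrite !inE /= => /and3P[_ /forall_inP f1I /forall_inP f1J].
  rewrite -(card_perm_agree _ f1); apply: subset_leq_card; apply/subsetP => f.
  rewrite !inE /= => /and3P[_ /forall_inP fI /forall_inP fJ].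
  apply/forall_inP => l /setUP[lI|lJ].
    by rewrite (eqP (fI l lI)) (eqP (f1I l lI)).
  by apply/eqP/(@perm_inj _ s); rewrite (eqP (fJ l lJ)) (eqP (f1J l lJ)).
have An : #|A| = #|I :&: J| by rewrite card_imset //; exact: perm_inj.
have -> : (#|I| + #|J| = #|I :|: J| + #|A|)%N by rewrite An cardsUI.
set q := #|_ :|: _|.
have qn : (q <= n)%N by rewrite max_card.
apply: (@le_trans _ _ ((#|V'| * (n - q)`!)%:R * (c * n%:R) ^+ (q + #|A|))).
  by rewrite ler_wpM2r ?ler_nat // exprn_ge0 // mulr_ge0 // ltW.
rewrite !natrM exprD.
have -> : #|V'|%:R * (n - q)`!%:R * ((c * n%:R) ^+ q * (c * n%:R) ^+ #|A|)
  = ((n - q)`!%:R * (c * n%:R) ^+ q) * (#|V'|%:R * (c * n%:R) ^+ #|A|) by ring.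
have cn0 : 0 <= c * n%:R by rewrite mulr_ge0 // ltW.
have mono x k : c <= x -> (c * n%:R) ^+ k <= (x * n%:R) ^+ k.
  move=> cx; have cxn : c * n%:R <= x * n%:R by rewrite ler_wpM2r.
  by apply: lerXn2r; rewrite ?nnegrE // (le_trans cn0).
rewrite ler_pM ?mulr_ge0 ?exprn_ge0 //.
  apply: le_trans (fact_sub_exp_le R qn); rewrite ler_wpM2l // [n%:R / 4]mulrC.
  by apply: mono; rewrite ge_min lexx orbT.
apply: le_trans (spread s0 A s0E); rewrite ler_wpM2l //.
by apply: mono; rewrite ge_min lexx.
Qed.

(** * From permutations to graph embeddings *)

Lemma sum_card_fibres (T U : finType) (X : {set T}) (g : T -> U) (A : {set U}) :
  (\sum_(e in A) #|[set p in X | g p == e]| = #|[set p in X | g p \in A]|)%N.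
Proof.
rewrite -sum1_card (partition_big g [in A]) /=; last by move=> p /[!inE] /andP[].
apply: eq_bigr => e eA; rewrite -sum1_card; apply: eq_bigl => p; rewrite !inE.
by case: eqVneq => [->|]; rewrite ?eA ?andbT ?andbF.
Qed.

Lemma enum_cardE (T : finType) (V : {set T}) (n : nat) : #|V| = n ->
  exists2 a : 'I_n -> T, injective a & forall v, v \in V = (v \in codom a).
Proof.
move=> <-; exists enum_val; first exact: enum_val_inj.
move=> v; apply/idP/codomP => [vV|[i ->]]; last exact: enum_valP.
by exists (enum_rank_in vV v); rewrite enum_rankK_in.
Qed.

Lemma min_degree_le (G : sgraph) (v : G) : (min_degree G <= degree v)%N.
Proof.
by rewrite /min_degree -minEnat -leEnat bigmin_le_cond.
Qed.

Lemma degree_codom (G : sgraph) (n : nat) (b : 'I_n -> G) (v : G) :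
  injective b -> (forall w, adj v w -> w \in codom b) ->
  degree v = #|[set j in setT | adj v (b j)]|.
Proof.
move=> b_inj vb; rewrite /degree -(card_imset _ b_inj); apply: eq_card => w.
rewrite inE; apply/idP/imsetP => [vw|[j /[!inE] /= ? ->] //].
by have /codomP[j wj] := vb w vw; exists j; rewrite // !inE -wj.
Qed.

Lemma card_set_bool (T : finType) (Z : {set T * bool}) :
  #|Z| = (#|[set l | (l, false) \in Z]| + #|[set l | (l, true) \in Z]|)%N.
Proof.
have inj (b : bool) : injective (fun l : T => (l, b)) by move=> l k [].
rewrite -(cardsID [set p | ~~ p.2] Z); congr (_ + _)%N.
  rewrite -(card_imset _ (inj false)).
  apply: eq_card => -[l b]; apply/idP/imsetP => [|[k + [-> ->]]]; rewrite !inE.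
    by move=> /andP[lZ /=]; case: b lZ => // lZ _; exists l; rewrite ?inE.
  by move=> ->.
rewrite -(card_imset _ (inj true)).
apply: eq_card => -[l b]; apply/idP/imsetP => [|[k + [-> ->]]]; rewrite !inE.
  by move=> /andP[/= + lZ]; case: b lZ => // lZ _; exists l; rewrite ?inE.
by move=> ->.
Qed.

(** The second permutation is the matching, the first labels its edges. Ends tagged [false] always
    land on the side enumerated by [a]. *)
Definition labelled_matching (n : nat) (V : Type) (a b : 'I_n -> V)
    (p : {perm 'I_n} * {perm 'I_n}) : {ffun 'I_n * bool -> V} :=
  [ffun x => if x.2 then b (p.2 (p.1 x.1)) else a (p.1 x.1)].

Theorem theorem2p5 :
  forall (R : realType) (eps : R), 0 < eps ->
  exists2 C : R, 0 < C &
  exists n0 : nat, forall n : nat, (n0 <= n)%N ->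
  forall (G : sgraph) (V1 V2 : {set G}),
    bipartition V1 V2 -> #|V1| = n -> #|V2| = n ->
    (2^-1 + eps) * n%:R <= (min_degree G)%:R ->
  exists mu : embedding (matching_graph n) G -> R,
    is_distribution mu /\ vertex_spread (C / n%:R) mu.
Proof.
move=> R eps eps0.
pose e := Num.min eps 2^-1.
have e0 : 0 < e by rewrite lt_min eps0 invr_gt0 ltr0n.
have e1 : e <= 2^-1 by rewrite ge_min lexx orbT.
have [c c0 [n0 spread]] := matchings_labelled_spread e0 e1.
exists c^-1; first by rewrite invr_gt0.
(* The second bound ensures [C / n <= 1], as [vertex_spread] demands. *)
exists (maxn n0 (Num.truncn c^-1).+1) => n; rewrite geq_max => /andP[nn0 nc].
move=> G V1 V2 [_ V12 adjV] V1n V2n deg_ge.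
have nc1 : c^-1 <= n%:R.
  by apply: ltW; apply: lt_le_trans (truncnS_gt _) _; rewrite ler_nat.
have nR : 0 < n%:R :> R by rewrite ltr0n (leq_trans _ nc).
have V2' v : v \in V2 -> v \notin V1.
  by move=> vV2; apply: contraL V12 => vV1; apply/pred0Pn; exists v; rewrite /= vV1.
have adj12 v w : v \in V1 -> adj v w -> w \in V2.
  by move=> vV1 /adjV /orP[/andP[]//|/andP[/V2']]; rewrite vV1.
have adj21 v w : v \in V2 -> adj v w -> w \in V1.
  by move=> vV2 /adjV /orP[/andP[]|/andP[]//]; rewrite (negPf (V2' v vV2)).
have [a a_inj aV] := enum_cardE V1n; have [b b_inj bV] := enum_cardE V2n.
have aV1 i : a i \in V1 by rewrite aV codom_f.
have bV2 i : b i \in V2 by rewrite bV codom_f.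
have ab i j : (a i == b j) = false.
  by apply: contraTF (aV1 i) => /eqP->; exact: V2'.
pose E i j := adj (a i) (b j).
have degE : min_semidegree E setT (min_degree G).
  move=> i _; rewrite /outdeg /indeg.
  rewrite -(@degree_codom _ _ b (a i)) //; last first.
    by move=> w /(adj12 _ _ (aV1 i)); rewrite bV.
  rewrite (eq_card (B := [set j in setT | adj (b i) (a j)])); last first.
    by move=> j; rewrite !inE /E adj_sym.
  rewrite -(@degree_codom _ _ a (b i)) ?min_degree_le //.
  by move=> w /(adj21 _ _ (bV2 i)); rewrite aV.
have [||PM0 {}spread] := spread _ E _ degE; first by rewrite card_ord.
  rewrite card_ord; apply: le_trans deg_ge; rewrite ler_wpM2r //.
  by rewrite lerD2l ge_min lexx.
rewrite card_ord in spread.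
set PM := perfect_matchings E in PM0 spread.
pose phi := labelled_matching a b.
have phi_emb p : p.2 \in PM -> @is_embedding (matching_graph n) G (phi p).
  rewrite inE => /forallP Ep; apply/andP; split.
    apply/injectiveP => -[i [|]] [j [|]]; rewrite !ffunE /=.
    - by move=> /b_inj/perm_inj/perm_inj->.
    - by move=> /eqP; rewrite eq_sym ab.
    - by move=> /eqP; rewrite ab.
    - by move=> /a_inj/perm_inj->.
  apply/forallP => -[i x]; apply/forallP => -[j y]; apply/implyP.
  move=> /andP[/= /eqP<-]; rewrite !ffunE /=.
  case: x; case: y => // _; last exact: Ep.
  by rewrite adj_sym; exact: Ep.
have /card_gt0P[s1 s1PM] := PM0.
(* Only a default value for [insubd]; on [X] the map [g] is [phi]. *)
pose phi0 : embedding (matching_graph n) G :=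
  exist (fun f => @is_embedding (matching_graph n) G f) _
    (phi_emb (1%g, s1) s1PM).
pose g p : embedding (matching_graph n) G := insubd phi0 (phi p).
have gE p : p.2 \in PM -> val (g p) = phi p.
  by move=> pPM; rewrite /g insubdK //; exact: (phi_emb p pPM).
pose X := [set p : {perm 'I_n} * {perm 'I_n} | p.2 \in PM].
have XE : #|X| = (n`! * #|PM|)%N.
  have -> : X = setX [set: {perm 'I_n}] PM by apply/setP => p; rewrite !inE.
  rewrite cardsX; congr (_ * _)%N.
  rewrite -[n in RHS]card_ord -cardsT -card_perm cardsE; apply: eq_card => s.
  by rewrite [RHS]unfold_in; apply/esym/subsetP => i; rewrite inE.
have X0 : 0 < #|X|%:R :> R by rewrite XE ltr0n muln_gt0 fact_gt0.
(* The push-forward under [g] of the uniform distribution on [X]. *)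
pose mu (f : embedding (matching_graph n) G) : R :=
  #|[set p in X | g p == f]|%:R / #|X|%:R.
have prob_mu A : prob mu A = #|[set p in X | g p \in A]|%:R / #|X|%:R.
  by rewrite /prob -mulr_suml -natr_sum sum_card_fibres.
exists mu; split.
  split=> [f|]; first by rewrite divr_ge0.
  rewrite -[LHS](eq_bigl _ _ (fun f => in_setT f)) -/(prob mu setT) prob_mu.
  have -> : [set p in X | g p \in [set: _]] = X.
    by apply/setP => p; rewrite !inE andbT.
  by rewrite divff // lt0r_neq0.
split.
  rewrite divr_ge0 ?invr_ge0 ?(ltW c0) //=.
  by rewrite ler_pdivrMr // mul1r.
move=> r x y x_inj y_inj; rewrite prob_mu.
set B := [set p in X | _].
(* If the event is nonempty, any of its members serves as the reference pair, and prescribing values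
   becomes agreeing with it. *)
have [->|[[f0 s0] B0]] := set_0Vmem B.
  by rewrite cards0 mul0r exprn_ge0 // divr_ge0 // invr_ge0 ltW.
have BE p : p \in B -> p.2 \in PM /\ forall i, phi p (x i) = y i.
  rewrite in_set => /andP[pX].
  have pPM : p.2 \in PM by move: pX; rewrite in_set.
  by rewrite in_set gE // => /forallP py; split=> // i; exact/eqP/py.
have [/= s0PM x0] := BE _ B0.
(* The prescribed vertices split into left ends [I] and right ends [J], numbering [r] in total
   because [x] is injective. *)
pose Z := x @: 'I_r.
pose I := [set l | (l, false) \in Z]; pose J := [set l | (l, true) \in Z].
have IJ : (#|I| + #|J|)%N = r by rewrite -card_set_bool card_imset ?card_ord.
have := spread f0 s0 I J s0PM; rewrite IJ -XE => spreadB.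
rewrite ler_pdivrMr // -[c^-1 / _]invfM exprVn mulrC ler_pdivlMr; last first.
  by rewrite exprn_gt0 // mulr_gt0.
apply: le_trans spreadB.
rewrite ler_wpM2r ?exprn_ge0 ?mulr_ge0 ?(ltW c0) // ler_nat.
apply: subset_leq_card; apply/subsetP => p /BE[pPM px].
rewrite inE pPM /=; apply/andP; split.
  apply/forall_inP => l; rewrite inE => /imsetP[i _ xi].
  by have := px i; rewrite -x0 -xi !ffunE /= => /a_inj ->.
apply/forall_inP => l; rewrite inE => /imsetP[i _ xi].
by have := px i; rewrite -x0 -xi !ffunE /= => /b_inj ->.
Qed.
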